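(* Let $(\Omega,\rho)$ be a metric space, let $\mathcal P$ be the set of all Borel probability measures on $\Omega$, let $r\in[1,\infty)$ and let $n\ge1$ be an integer. Then \[ \inf_{\hat P}\ \sup_{P\in\mathcal P}\ \mathbb E_{X_1,\dots,X_n\overset{iid}{\sim}P}\Big[W_r^r\big(P,\hat P(X_1,\dots,X_n)\big)\Big]\;\ge\; c_r\sup_{k\in\{2,\dots,32n\}}R^r(k)\sqrt{\frac{k-1}{n}},\qquad c_r=\frac{3\log 2}{2^{r+12}}, \] where the infimum is over all estimators, i.e. all (possibly randomized) maps $\hat P:\Omega^n\to\mathcal P$. (If the right-hand side is $+\infty$, the claim is that the left-hand side is $+\infty$.)
   Context: For Borel probability measures $P,Q$ on $(\Omega,\rho)$ and $r\ge1$, $W_r(P,Q):=\inf_{\mu\in\Pi(P,Q)}\big(\mathbb E_{(X,Y)\sim\mu}[\rho^r(X,Y)]\big)^{1/r}$, with $\Pi(P,Q)$ the set of couplings (probability measures on $\Omega\times\Omega$ with marginals $P,Q$). For $S\subseteq\Omega$, the separation is $\mathrm{Sep}(S):=\inf_{x\ne y\in S}\rho(x,y)$. The packing radius is $R(k):=\sup\{\mathrm{Sep}(S): S\subseteq\Omega,\ |S|\ge k\}\in[0,\infty]$, with the convention $R(k)=0$ if $\Omega$ has fewer than $k$ points. *)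

(* Defs.v *)
From HB Require Import structures.
From mathcomp Require Import all_boot all_order all_algebra.
From mathcomp Require Import all_classical all_reals all_analysis.
From mathcomp Require Import measurable_realfun.

Set Implicit Arguments.
Unset Strict Implicit.
Unset Printing Implicit Defensive.

Import Order.TTheory GRing.Theory Num.Def Num.Theory.

Local Open Scope classical_set_scope.
Local Open Scope ring_scope.

(** A (nonempty) metric space: a metric type (distance [mdist], whose
    topology is the metric topology) together with a distinguished point,
    needed by MathComp-Analysis to build measurable types. *)
#[short(type="pointedMetricType")]
HB.structure Definition PointedMetric (K : numDomainType) :=
  { M of Pointed M & Metric K M }.

Section wasserstein_defs.
Context {R : realType} (T : pointedMetricType R).

Local Notation borel := (g_sigma_algebraType (@open T)).

(** Borel sigma-algebra of T x T (product topology = metric topology of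
    the max-metric). Couplings live on this space. *)
Local Notation borel2 := (g_sigma_algebraType (@open (T * T)%type)).

Definition Prob := probability borel R.

Definition coupling (P Q : Prob) (mu : probability borel2 R) : Prop :=
  forall A : set borel, measurable A ->
    mu (@fst T T @^-1` A) = P A /\ mu (@snd T T @^-1` A) = Q A.

Definition Wass (r : R) (P Q : Prob) : \bar R :=
  ereal_inf [set ((\int[mu]_z ((@mdist R T z.1 z.2) `^ r)%:E) `^ r^-1)%E
            | mu in [set mu | coupling P Q mu]].

Definition atleast (S : set T) (k : nat) : Prop :=
  exists f : 'I_k -> T, injective f /\ (forall i, S (f i)).

Definition Sep (S : set T) : \bar R :=
  ereal_inf [set z | exists x y, [/\ S x, S y, x <> y & z = (@mdist R T x y)%:E]].

Definition packing_radius (k : nat) : \bar R :=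
  if `[< exists S, atleast S k >] then
    ereal_sup [set Sep S | S in [set S | atleast S k]]
  else 0%E.

Fixpoint iid_int (P : Prob) (n : nat) : (n.-tuple borel -> \bar R) -> \bar R :=
  match n return (n.-tuple borel -> \bar R) -> \bar R with
  | 0 => fun f => f [tuple]
  | m.+1 => fun f => (\int[P]_x iid_int P (fun t => f (cons_tuple x t)))%E
  end.

End wasserstein_defs.

Notation borel T := (g_sigma_algebraType (@open T)).

(* Main.v *)
(** Fix k points at pairwise distance at least s > 0. If P is supported on these
    points with masses p_i, any mass that a coupling moves out of the open ball of
    radius s/2 around the i-th point costs at least (s/2)^r; the balls being
    disjoint, W_r^r(P, Q) >= (s/2)^r sum_i (p_i - Q(B_i))^+. Hence estimating P
    in W_r^r is at least as hard as estimating a multinomial in total variation,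
    and neither the triangle inequality for W_r nor a gluing of couplings is
    needed. The multinomial bound is Assouad's: pair up the points into m = k/2
    pairs and give the two points of the j-th pair the masses (1 +- eps)/(2m),
    with the sign an unknown bit tau_j and eps = sqrt((k-1)/n)/8. Flipping one bit
    keeps the Hellinger affinity of the n-fold products at least 31/32, which
    costs each pair a loss of order eps/m on average over tau. *)

Require Import Defs.
From HB Require Import structures.
From mathcomp Require Import all_boot all_order all_algebra.
From mathcomp Require Import all_classical all_reals all_analysis.
From mathcomp Require Import measurable_realfun.
From mathcomp Require Import ring lra.

Import Order.TTheory GRing.Theory Num.Def Num.Theory.
Local Open Scope classical_set_scope.
Local Open Scope ring_scope.

(** * Assouad's lemma for paired multinomial distributions *)

Lemma big_tuple_cons (V : Type) (idx : V) (op : Monoid.com_law idx)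
    (X : finType) (n : nat) (F : n.+1.-tuple X -> V) :
  \big[op/idx]_(t : n.+1.-tuple X) F t =
  \big[op/idx]_(x : X) \big[op/idx]_(t : n.-tuple X) F (cons_tuple x t).
Proof.
rewrite pair_bigA /=.
rewrite (reindex (fun xt : X * n.-tuple X => cons_tuple xt.1 xt.2)) //.
exists (fun t : n.+1.-tuple X => (thead t, behead_tuple t)) => [[x t] _|t _] /=.
  by congr pair; apply: val_inj.
by case/tupleP: t => x t; apply: val_inj.
Qed.

Lemma sum_tuple_prod (R : comPzSemiRingType) (X : finType) (p : X -> R) (n : nat) :
  \sum_(t : n.-tuple X) \prod_(x <- t) p x = (\sum_x p x) ^+ n.
Proof.
elim: n => [|n IH].
  rewrite expr0 (eq_bigl (pred1 [tuple])) ?big_pred1_eq ?big_nil//.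
  by move=> t; apply/esym/eqP/tuple0.
rewrite big_tuple_cons exprS big_distrl /=; apply: eq_bigr => x _.
by rewrite -IH big_distrr /=; apply: eq_bigr => t _; rewrite big_cons.
Qed.

Lemma bernoulli_ineq (R : realDomainType) (x : R) (n : nat) :
  0 <= x <= 1 -> 1 - n%:R * x <= (1 - x) ^+ n.
Proof.
case/andP=> x0 x1; elim: n => [|n IH]; first by rewrite mul0r subr0 expr0.
rewrite exprS (le_trans _ (ler_wpM2l _ IH)) ?subr_ge0//.
have := ler0n R n; rewrite -natr1; nra.
Qed.

(* [h ^+ 2 <= p p'] passes to products, and [H ^+ 2 <= A B] gives
   [H <= min A B + max A B / 4] by AM-GM; [h] plays the role of the Hellinger
   affinity density [sqrt (p p')]. *)
Lemma two_point_testing (R : realFieldType) (X : finType) (n : nat)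
    (p p' h : X -> R) (F G : n.-tuple X -> R) (delta : R) :
  (forall x, 0 <= p x) -> (forall x, 0 <= p' x) -> (forall x, 0 <= h x) ->
  (forall x, h x ^+ 2 <= p x * p' x) ->
  \sum_x p x = 1 -> \sum_x p' x = 1 -> 0 <= delta ->
  (forall t, 0 <= F t) -> (forall t, 0 <= G t) ->
  (forall t, delta <= F t + G t) ->
  delta * ((4 * (\sum_x h x) ^+ n - 2) / 3) <=
  \sum_(t : n.-tuple X)
     ((\prod_(x <- t) p x) * F t + (\prod_(x <- t) p' x) * G t).
Proof.
move=> p0 p'0 h0 hpp sp sp' d0 F0 G0 dFG.
rewrite -sum_tuple_prod.
(* The constant 2 becomes the total mass of the two product laws, so that the claim can be checked
   tuple by tuple. *)
have -> : 2 = (\sum_x p x) ^+ n + (\sum_x p' x) ^+ n :> R.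
  by rewrite sp sp' !expr1n.
rewrite -!sum_tuple_prod mulr_sumr -big_split -sumrB mulr_suml mulr_sumr /=.
apply: ler_sum => t _.
have prod0 (g : X -> R) : (forall x, 0 <= g x) -> 0 <= \prod_(x <- t) g x.
  by move=> g0; apply: prodr_ge0.
have : (\prod_(x <- t) h x) ^+ 2 <= (\prod_(x <- t) p x) * (\prod_(x <- t) p' x).
  rewrite -prodrXl -big_split /=; apply: ler_prod => x _.
  by rewrite sqr_ge0 hpp.
move: (prod0 _ h0) (prod0 _ p0) (prod0 _ p'0) (F0 t) (G0 t) (dFG t).
set H := \prod_(x <- t) h x; set A := \prod_(x <- t) p x.
set B := \prod_(x <- t) p' x => H0 A0 B0 f0 g0 dfg HAB.
(* [(a + b / 4) ^+ 2 - a * b] is the square of [a - b / 4]. Used in both orders, this gives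
   [4 H - (A + B) <= 3 min A B]. *)
have amgm (a b : R) : 0 <= a -> 0 <= b -> H ^+ 2 <= a * b -> H <= a + b / 4.
  move=> a0 b0 Hab; rewrite -(@ler_pXn2r _ 2)// ?nnegrE ?addr_ge0 ?divr_ge0//.
  by rewrite (le_trans Hab)// -subr_ge0; have := sqr_ge0 (a - b / 4); nra.
have HA := amgm A B A0 B0 HAB.
have HB := amgm B A B0 A0 (le_trans HAB (eqbLR (congr1 _ (mulrC A B)) (lexx _))).
(* Replacing both weights by the smaller one leaves at least [delta] times that weight. *)
have [AB|BA] := leP A B.
  apply: (@le_trans _ _ (delta * A)); first by rewrite ler_wpM2l//; lra.
  have := ler_wpM2l A0 dfg; have := ler_wpM2r g0 AB; lra.
apply: (@le_trans _ _ (delta * B)); first by rewrite ler_wpM2l//; lra.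
have := ler_wpM2l B0 dfg; have := ler_wpM2r f0 (ltW BA); lra.
Qed.

(** The positive part of [u] is [(|u| + u) / 2], and the differences [p - q] have nonnegative sum.
    Here [q] may have smaller total mass, as an estimate may put mass outside the balls. *)
Lemma sum_pos_part_ge (R : realFieldType) (X : finType) (p q : X -> R) :
  \sum_x q x <= \sum_x p x ->
  (\sum_x `|p x - q x|) / 2 <= \sum_x Num.max 0 (p x - q x).
Proof.
rewrite -subr_ge0 -sumrB => qp.
have -> : \sum_x Num.max 0 (p x - q x) =
    (\sum_x `|p x - q x| + \sum_x (p x - q x)) / 2.
  rewrite -big_split mulr_suml /=; apply: eq_bigr => x _.
  rewrite maxEle; case: ifPn => [h|]; first by rewrite ger0_norm//; lra.
  by rewrite -ltNge => /ltW h; rewrite ler0_norm//; lra.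
lra.
Qed.

(** * Assouad's hypercube of paired weights *)

Section assouad.
Context (R : realFieldType) (m : nat) (eps : R).
Context (m_gt0 : (0 < m)%N) (eps01 : 0 <= eps <= 1).

(** The heavier point of the pair [j] is the one whose bit equals [tau j]. *)
Definition paired_weight (tau : {ffun 'I_m -> bool}) (x : 'I_m * bool) : R :=
  (1 + (-1) ^+ (x.2 (+) tau x.1) * eps) / (2 * m)%:R.

Let m2_gt0 : 0 < (2 * m)%:R :> R. Proof. by rewrite ltr0n muln_gt0. Qed.

Lemma sum_pairs (F : 'I_m * bool -> R) :
  \sum_x F x = \sum_(j < m) (F (j, true) + F (j, false)).
Proof.
transitivity (\sum_(j < m) \sum_(b : bool) F (j, b)).
  by rewrite pair_bigA; apply: eq_bigr => -[].
by apply: eq_bigr => j _; rewrite big_bool.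
Qed.

Lemma paired_weight_ge0 tau x : 0 <= paired_weight tau x.
Proof.
case/andP: eps01 => e0 e1; rewrite divr_ge0 ?ler0n//.
by case: (_ (+) _); rewrite /= ?expr0 ?expr1; lra.
Qed.

Lemma sum_paired_weight tau : \sum_x paired_weight tau x = 1.
Proof.
rewrite sum_pairs (eq_bigr (fun=> m%:R^-1)) => [|j _].
  by rewrite sumr_const card_ord -[LHS]mulr_natl mulfV// pnatr_eq0 -lt0n.
have mR : m%:R != 0 :> R by rewrite pnatr_eq0 -lt0n.
rewrite /paired_weight /= natrM.
by case: (tau j); rewrite /= ?expr0 ?expr1; field.
Qed.

Definition flip (j : 'I_m) (tau : {ffun 'I_m -> bool}) : {ffun 'I_m -> bool} :=
  [ffun i => tau i (+) (i == j)].

Lemma flipK j : involutive (flip j).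
Proof.
by move=> tau; apply/ffunP => i; rewrite !ffunE -addbA addbb addbF.
Qed.

(** The share of the pair [j] in the l1 distance. Absolute values are used because they obey the
    triangle inequality; positive parts return in [assouad]. *)
Definition pair_deviation tau (q : 'I_m * bool -> R) (j : 'I_m) : R :=
  `|paired_weight tau (j, true) - q (j, true)| +
  `|paired_weight tau (j, false) - q (j, false)|.

Lemma pair_deviation_ge0 tau q j : 0 <= pair_deviation tau q j.
Proof. by rewrite addr_ge0. Qed.

(** On the pair [j] no estimate is close to both weight vectors, while [n] samples hardly
    distinguish them: the flip changes only this pair, of total mass [1 / m]. *)
Lemma assouad_testing (n : nat) (j : 'I_m) (tau : {ffun 'I_m -> bool})
    (q : n.-tuple ('I_m * bool) -> 'I_m * bool -> R) :
  n%:R * (eps ^+ 2 / m%:R) <= 1 / 32 ->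
  eps / m%:R <=
  \sum_(t : n.-tuple ('I_m * bool))
     ((\prod_(x <- t) paired_weight tau x) * pair_deviation tau (q t) j +
      (\prod_(x <- t) paired_weight (flip j tau) x) * pair_deviation (flip j tau) (q t) j).
Proof.
move=> neps; have mR : 0 < m%:R :> R by rewrite ltr0n.
(* On the pair [j] the exact affinity is [sqrt (1 - eps ^+ 2) / (2 m)]; dropping the root only
   lowers it and keeps everything rational. *)
pose h (x : 'I_m * bool) : R :=
  if x.1 == j then (1 - eps ^+ 2) / (2 * m)%:R else paired_weight tau x.
have eps2 : 0 <= eps ^+ 2 <= 1 by case/andP: eps01 => *; rewrite sqr_ge0 expr_le1.
have sumh : \sum_x h x = 1 - eps ^+ 2 / m%:R.
  transitivity (\sum_x paired_weight tau x - eps ^+ 2 / m%:R); last first.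
    by rewrite sum_paired_weight.
  rewrite !sum_pairs (bigD1 j)//= [in RHS](bigD1 j)//=.
  rewrite {1 2}/h /= eqxx.
  rewrite (eq_bigr (fun i => paired_weight tau (i, true) +
    paired_weight tau (i, false))) => [|i ij].
    rewrite [RHS]addrAC; congr (_ + _); rewrite /paired_weight /= natrM.
    by case: (tau j); rewrite /= ?expr0 ?expr1; field; rewrite gt_eqF.
  by rewrite /h /= (negbTE ij).
(* The flip exchanges the weights [(1 + eps) / (2 m)] and [(1 - eps) / (2 m)]; by the triangle
   inequality each of the two points contributes [eps / m]. *)
have sep t : 2 * (eps / m%:R) <= pair_deviation tau (q t) j + pair_deviation (flip j tau) (q t) j.
  rewrite /pair_deviation /paired_weight !ffunE eqxx addbT natrM.
  set a := q t (j, true); set b := q t (j, false).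
  have key (u v w : R) : `|u - v| <= `|u - w| + `|v - w|.
    by rewrite (distrC v) (le_trans _ (ler_normD _ _))// addrA subrK.
  have e0 : 0 <= eps / m%:R by case/andP: eps01 => ? _; rewrite divr_ge0.
  pose u : R := (1 + eps) / (2 * m%:R); pose v : R := (1 - eps) / (2 * m%:R).
  have uv : `|u - v| = eps / m%:R.
    have -> : u - v = eps / m%:R by rewrite /u /v; field; rewrite gt_eqF.
    by rewrite ger0_norm.
  have := key u v a; have := key u v b; rewrite uv.
  by case: (tau j); rewrite /= ?expr0 ?expr1 ?mul1r ?mulN1r -/u -/v; lra.
have := @two_point_testing R _ n (paired_weight tau) (paired_weight (flip j tau))
  h (fun t => pair_deviation tau (q t) j)
  (fun t => pair_deviation (flip j tau) (q t) j) (2 * (eps / m%:R)).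
rewrite sumh; move=> /(_ (paired_weight_ge0 _) (paired_weight_ge0 _)).
move=> /(_ _ _ (sum_paired_weight _) (sum_paired_weight _)) H.
apply: le_trans (H _ _ _ _ _ sep).
- have e0 : 0 <= eps / m%:R by case/andP: eps01 => ? _; rewrite divr_ge0.
  have e1 : 0 <= eps ^+ 2 / m%:R <= 1.
    case/andP: eps2 => ? ?; rewrite divr_ge0 ?ler0n//=.
    by rewrite ler_pdivrMr// mul1r (@le_trans _ _ 1)// ler1n.
  (* Bernoulli gives [B >= 31 / 32], so [(4 B - 2) / 3] is at least [5 / 8], above the [1 / 2]
     required. *)
  have := bernoulli_ineq _ _ n e1.
  by set B := (_ ^+ n) => HB; nra.
- move=> x; rewrite /h; case: ifP => _; last exact: paired_weight_ge0.
  by rewrite divr_ge0 ?ler0n// subr_ge0; case/andP: eps2.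
- move=> x; rewrite /h; case: ifPn => [/eqP xj|xj].
    rewrite /paired_weight !ffunE xj eqxx addbT addbN.
    rewrite expr_div_n mulrACA -invfM -expr2 ler_pM2r ?invr_gt0 ?exprn_gt0//.
    by case: (_ (+) _) => /=; rewrite ?expr0 ?expr1; nra.
  by rewrite /paired_weight !ffunE (negbTE xj) addbF expr2.
- by rewrite mulr_ge0// divr_ge0; case/andP: eps01.
- by move=> t; exact: pair_deviation_ge0.
- by move=> t; exact: pair_deviation_ge0.
Qed.

Lemma assouad (n : nat) (q : n.-tuple ('I_m * bool) -> 'I_m * bool -> R) :
  n%:R * (eps ^+ 2 / m%:R) <= 1 / 32 -> (forall t, \sum_x q t x <= 1) ->
  #|{ffun 'I_m -> bool}|%:R * (eps / 4) <=
  \sum_tau \sum_(t : n.-tuple ('I_m * bool))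
    (\prod_(x <- t) paired_weight tau x) *
      \sum_x Num.max 0 (paired_weight tau x - q t x).
Proof.
move=> neps q1.
pose A tau j := \sum_(t : n.-tuple ('I_m * bool))
  (\prod_(x <- t) paired_weight tau x) * pair_deviation tau (q t) j.
have m_neq0 : m%:R != 0 :> R by rewrite pnatr_eq0 -lt0n.
(* In [eps / 4], one factor [1 / 2] comes from pairing [tau] with [flip j tau], the other from
   passing from absolute values to positive parts. *)
apply: (@le_trans _ _ ((\sum_tau \sum_(j < m) A tau j) / 2)).
  rewrite exchange_big /=.
  rewrite (_ : _ * _ = (\sum_(j < m)
      #|{ffun 'I_m -> bool}|%:R * (eps / m%:R / 2)) / 2); last first.
    by rewrite sumr_const card_ord -mulr_natl; field.
  rewrite ler_pM2r ?invr_gt0//; apply: ler_sum => j _.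
  rewrite (_ : \sum_tau A tau j = (\sum_tau (A tau j + A (flip j tau) j)) / 2).
    rewrite mulrA ler_pM2r ?invr_gt0// mulr_natl -sumr_const.
    apply: ler_sum => tau _; rewrite /A -big_split /=.
    exact: assouad_testing.
  have flipE : \sum_tau A (flip j tau) j = \sum_tau A tau j.
    by rewrite [RHS](reindex_inj (inv_inj (flipK j))).
  by rewrite big_split /= flipE; field.
rewrite mulr_suml; apply: ler_sum => tau _.
rewrite /A exchange_big /= mulr_suml; apply: ler_sum => t _.
rewrite -mulr_sumr -mulrA ler_wpM2l//.
  by apply: prodr_ge0 => x _; exact: paired_weight_ge0.
apply: le_trans (sum_pos_part_ge _ _ _ _ _); last by rewrite sum_paired_weight.
by rewrite sum_pairs.
Qed.

End assouad.

(** * Lower bound on the Wasserstein distance *)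

Section metric_borel.
Context {R : realType} (T : pointedMetricType R).

Local Notation borel2 := (g_sigma_algebraType (@open (T * T)%type)).

Lemma metric_ball_open (x : T) (e : R) : open (ball x e).
Proof.
rewrite openE => y; rewrite ballEmdist /= => xy.
apply/nbhs_ballP; exists (e - mdist x y); first by rewrite /= subr_gt0.
move=> z; rewrite !ballEmdist /= => yz.
by rewrite (le_lt_trans (metric_triangle x y z))// -ltrBrDl.
Qed.

Lemma measurable_metric_ball (x : T) (e : R) :
  measurable (ball x e : set (borel T)).
Proof. by apply: sub_sigma_algebra; exact: metric_ball_open. Qed.

Lemma open_fst_preimage (A : set T) : open A -> open (@fst T T @^-1` A).
Proof. by apply: open_comp => z _; exact: cvg_fst. Qed.

Lemma open_snd_preimage (A : set T) : open A -> open (@snd T T @^-1` A).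
Proof. by apply: open_comp => z _; exact: cvg_snd. Qed.

Lemma measurable_fst_borel2 :
  measurable_fun [set: borel2] (@fst T T : borel2 -> borel T).
Proof.
apply: (@measurability _ _ borel2 (borel T) _ _ (@open T)) => // _ [A oA <-].
rewrite setTI.
by apply: sub_sigma_algebra; exact: open_fst_preimage.
Qed.

Lemma measurable_snd_borel2 :
  measurable_fun [set: borel2] (@snd T T : borel2 -> borel T).
Proof.
apply: (@measurability _ _ borel2 (borel T) _ _ (@open T)) => // _ [A oA <-].
rewrite setTI.
by apply: sub_sigma_algebra; exact: open_snd_preimage.
Qed.

Lemma measurable_metric_set1 (x : T) : measurable ([set x] : set (borel T)).
Proof.
rewrite -[X in measurable X]setCK; apply: measurableC; apply: sub_sigma_algebra.
apply: closed_openC; apply: accessible_closed_set1; apply: hausdorff_accessible.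
exact: metric_hausdorff.
Qed.

(** The sigma-algebra of [borel2] contains all open sets of the product, and [{mdist > a}] is open:
    moving each coordinate by less than half the excess over [a] keeps the distance above [a]. *)
Lemma measurable_mdist :
  measurable_fun [set: borel2] (fun z : borel2 => @mdist R T z.1 z.2).
Proof.
apply: (measurability _ (RGenOInfty.measurableE R)) => _ [_ [a ->] <-].
rewrite setTI; apply: sub_sigma_algebra; rewrite /= openE => -[x y] /=.
rewrite in_itv /= andbT => axy.
pose e := (mdist x y - a) / 2.
have e0 : 0 < e by rewrite divr_gt0// subr_gt0.
exists (ball x e, ball y e); first by split; exact: nbhsx_ballx.
move=> [x' y'] [/=]; rewrite !ballEmdist in_itv /= andbT => xx' yy'.
have := metric_triangle x x' y; have := metric_triangle x' y' y.
rewrite (metric_sym y' y) => h1 h2; rewrite /e in xx' yy'; lra.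
Qed.

End metric_borel.

(** * Transport cost forced by a mass deficit *)

Section wasserstein_lower_bound.
Context {R : realType} (T : pointedMetricType R).

Local Notation borel2 := (g_sigma_algebraType (@open (T * T)%type)).

(** The maps [x ^ (1 / r)] and [x ^ r] are monotone on [[0, +oo]], so a bound common to all
    couplings passes through the infimum of roots. *)
Lemma Wass_pow_ge (r c : R) (P Q : Prob T) : 0 < r -> 0 <= c ->
  (forall mu : probability borel2 R, coupling P Q mu ->
    (c%:E <= \int[mu]_z ((@mdist R T z.1 z.2) `^ r)%:E)%E) ->
  (c%:E <= Wass r P Q `^ r)%E.
Proof.
move=> r0 c0 cmu.
have cW : ((c `^ r^-1)%:E <= Wass r P Q)%E.
  apply: le_ereal_inf_tmp => _ [mu Pmu <-]; rewrite -poweR_EFin.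
  apply: gt0_ler_poweR; first by rewrite invr_ge0 ltW.
  - by rewrite in_itv /= lee_fin c0 leey.
  - rewrite in_itv /= leey andbT integral_ge0// => z _.
    by rewrite lee_fin powR_ge0.
  - exact: cmu.
rewrite -[c](@powRr1 R)// -(mulVf (lt0r_neq0 r0)) powRrM -poweR_EFin.
apply: gt0_ler_poweR; first exact: ltW.
- by rewrite in_itv /= leey andbT lee_fin powR_ge0.
- by rewrite in_itv /= leey andbT (le_trans _ cW)// lee_fin powR_ge0.
- exact: cW.
Qed.

Lemma sum_measure_trivIset d (S : measurableType d) (X : finType)
    (mu : {measure set S -> \bar R}) (F : X -> set S) :
  (forall x, measurable (F x)) -> trivIset [set: X] F ->
  (\sum_x mu (F x) = mu (\big[setU/set0]_x F x))%E.
Proof.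
move=> mF tF; pose D := \big[setU/set0]_x F x.
have mD : measurable D by exact: bigsetU_measurable.
rewrite -[RHS]mul1e -(@integral_cst _ _ _ mu _ mD 1%E).
rewrite ge0_integral_bigsetU//=; last 2 first.
- exact: index_enum_uniq.
- exact: sub_trivIset tF.
by apply: eq_bigr => x _; rewrite integral_cst//= mul1e.
Qed.

Lemma trivIset_ball (X : finType) (f : X -> T) (s : R) :
  (forall x y, x != y -> s <= mdist (f x) (f y)) ->
  trivIset [set: X] (fun x => ball (f x) (s / 2)).
Proof.
move=> sep x y _ _ [z []]; rewrite !ballEmdist /= => xz yz.
apply/eqP/negP => /negP /sep; have := metric_triangle (f x) z (f y).
by rewrite (metric_sym z); lra.
Qed.

Lemma sum_ball_le1 (X : finType) (f : X -> T) (s : R) (Q : Prob T) :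
  (forall x y, x != y -> s <= mdist (f x) (f y)) ->
  \sum_x fine (Q (ball (f x) (s / 2))) <= 1.
Proof.
move=> sep; rewrite -lee_fin -sumEFin.
have mB x : measurable (ball (f x) (s / 2) : set (borel T)).
  exact: measurable_metric_ball.
under eq_bigr do rewrite fineK ?fin_num_measure//.
rewrite sum_measure_trivIset//; last exact: trivIset_ball.
by apply: probability_le1; exact: bigsetU_measurable.
Qed.

Lemma Wass_pow_ge_mass_deficit (X : finType) (f : X -> T) (p : X -> R)
    (r s : R) (P Q : Prob T) : 0 < r -> 0 < s ->
  (forall x y, x != y -> s <= mdist (f x) (f y)) ->
  (forall x, ((p x)%:E <= P [set f x])%E) ->
  (((s / 2) `^ r * \sum_x Num.max 0 (p x - fine (Q (ball (f x) (s / 2)))))%:E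
    <= Wass r P Q `^ r)%E.
Proof.
move=> r0 s0 sep pP; apply: Wass_pow_ge => //.
  by rewrite mulr_ge0 ?powR_ge0// sumr_ge0// => x _; rewrite le_max lexx.
move=> mu PQmu.
pose B x : set (borel T) := ball (f x) (s / 2).
have mB x : measurable (B x) by exact: measurable_metric_ball.
have mX x : measurable ([set f x] : set (borel T)).
  exact: measurable_metric_set1.
have mfst (A : set (borel T)) :
    measurable A -> measurable (fst @^-1` A : set borel2).
  by move=> mA; rewrite -[X in measurable X]setTI; exact: measurable_fst_borel2.
have msnd (A : set (borel T)) :
    measurable A -> measurable (snd @^-1` A : set borel2).
  by move=> mA; rewrite -[X in measurable X]setTI; exact: measurable_snd_borel2.
(* The mass that starts at [f x] and lands outside its ball. These sets are disjoint because their
   first coordinates are distinct centres. *)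
pose D x : set borel2 := fst @^-1` [set f x] `\` snd @^-1` (B x).
have mD x : measurable (D x) by apply: measurableD; [exact: mfst|exact: msnd].
have tD : trivIset [set: X] D.
  move=> x y _ _ [z [[/= zx _] [/= zy _]]]; apply/eqP/negP => /negP /sep.
  by rewrite -zx -zy mdistxx leNgt s0.
have mcost : measurable_fun [set: borel2]
    (fun z : borel2 => ((@mdist R T z.1 z.2) `^ r)%:E).
  apply/measurable_EFinP; apply: (measurableT_comp (measurable_powR r)).
  exact: measurable_mdist.
have mUD : measurable (\big[setU/set0]_x D x) by exact: bigsetU_measurable.
apply: (@le_trans _ _ (\int[mu]_(z in \big[setU/set0]_x D x)
    ((@mdist R T z.1 z.2) `^ r)%:E)%E); last first.
  apply: ge0_subset_integral => // z _; by rewrite lee_fin powR_ge0.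
rewrite ge0_integral_bigsetU//=; last 4 first.
- exact: index_enum_uniq.
- exact: sub_trivIset tD.
- exact: measurable_funTS.
- by move=> z _; rewrite lee_fin powR_ge0.
rewrite mulr_sumr -sumEFin; apply: lee_sum => x _.
apply: (@le_trans _ _ (\int[mu]_(z in D x) ((s / 2) `^ r)%:E)%E); last first.
  apply: ge0_le_integral => //.
  - by move=> z _; rewrite lee_fin powR_ge0.
  - exact: measurable_funTS.
  - move=> z [/= zx]; rewrite /B ballEmdist zx /= => /negP; rewrite -leNgt => sz.
    by rewrite lee_fin ge0_ler_powR// ?nnegrE ?mdist_ge0// ltW// divr_gt0.
rewrite integral_cst// EFinM lee_wpmul2l// ?lee_fin ?powR_ge0//.
have [Pmu Qmu] : mu (fst @^-1` [set f x]) = P [set f x] /\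
    mu (snd @^-1` (B x)) = Q (B x).
  by split; [exact: (PQmu _ (mX x)).1|exact: (PQmu _ (mB x)).2].
have QB : Q (B x) \is a fin_num by rewrite fin_num_measure.
rewrite -/(B x) EFin_max ge_max measure_ge0 /= EFinB fineK// leeBlDr//.
apply: (le_trans (pP x)); rewrite -Pmu -Qmu.
(* Mass starting at [f x] either lies in [D x] or ends in [B x]. *)
apply: le_trans (measureU2 _ (mD x) (msnd _ (mB x))).
apply: le_measure; rewrite ?inE//; first exact: mfst.
- by apply: measurableU => //; exact: msnd.
- by move=> z zx; have [zB|zB] := pselect (B x z.2); [right|left].
Qed.

End wasserstein_lower_bound.

(** * Finitely supported probabilities and the minimax bound *)

Section discrete_probability.
Context d {S : measurableType d} {R : realType} (X : finType).
Context (f : X -> S) (p : X -> R).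
Context (p0 : forall x, 0 <= p x) (p1 : \sum_x p x = 1).

(** [msum] runs over natural indices, so [X] is enumerated and indices out of range receive the zero
    measure. *)
Let weighted_dirac (i : nat) : {measure set S -> \bar R} :=
  if insub i is Some j then mscale (NngNum (p0 (@enum_val X X j)))
    (\d_(f (@enum_val X X j))) else mzero.

Definition discrete_measure := msum weighted_dirac #|X|.

HB.instance Definition _ := Measure.on discrete_measure.

Lemma integral_discrete_measure (g : S -> \bar R) :
  measurable_fun [set: S] g -> (forall y, 0 <= g y)%E ->
  (\int[discrete_measure]_y g y = \sum_x (p x)%:E * g (f x))%E.
Proof.
move=> mg g0; rewrite /discrete_measure ge0_integral_measure_sum//.
rewrite (big_enum_val (A := X)) /=; apply: eq_bigr => i _.
rewrite /weighted_dirac valK ge0_integral_mscale//= integral_dirac//.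
by rewrite diracT mul1e.
Qed.

Let discrete_measure_setT : discrete_measure [set: S] = 1%E.
Proof.
rewrite -[LHS]mul1e -(@integral_cst _ _ _ _ _ measurableT 1%E).
rewrite integral_discrete_measure//=.
by under eq_bigr do rewrite mule1; rewrite sumEFin p1.
Qed.

HB.instance Definition _ :=
  Measure_isProbability.Build _ _ _ discrete_measure discrete_measure_setT.

Definition discrete_probability : probability S R := discrete_measure.

Lemma integral_discrete_probability (g : S -> \bar R) :
  measurable_fun [set: S] g -> (forall y, 0 <= g y)%E ->
  (\int[discrete_probability]_y g y = \sum_x (p x)%:E * g (f x))%E.
Proof. exact: integral_discrete_measure. Qed.

(** An inequality only, since [f] may send other elements of [X] to the same point. *)
Lemma discrete_probability_ge (x : X) : measurable [set f x] ->
  ((p x)%:E <= discrete_probability [set f x])%E.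
Proof.
move=> mx; rewrite -[leRHS]mul1e -(@integral_cst _ _ _ _ _ mx 1%E).
rewrite integral_mkcond integral_discrete_probability; last 2 first.
- by apply/(measurable_restrictT _ mx); exact: measurable_cst.
- by move=> y; rewrite patchE; case: ifP.
rewrite (bigD1 x)//= patchE mem_set// mule1 leeDl// sume_ge0// => y _.
by rewrite mule_ge0 ?lee_fin// patchE; case: ifP.
Qed.

End discrete_probability.
Arguments discrete_probability {d S R X} f {p} p0 p1.

Section iid_discrete.
Context {R : realType} (T : pointedMetricType R) (X : finType).
Context (f : X -> T) (p : X -> R).
Context (p0 : forall x, 0 <= p x) (p1 : \sum_x p x = 1).

(** Fixing the head or the tail of the sample leaves a measurable function, so by induction each
    nested integral becomes a finite sum. *)
Lemma iid_int_discrete (n : nat) (g : n.-tuple (borel T) -> \bar R) :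
  measurable_fun [set: n.-tuple (borel T)] g -> (forall t, 0 <= g t)%E ->
  iid_int (discrete_probability (f : X -> borel T) p0 p1) g =
  (\sum_(t : n.-tuple X) (\prod_(x <- t) p x)%:E * g (map_tuple f t))%E.
Proof.
elim: n g => [|n IH] g mg g0 /=.
  rewrite (eq_bigl (pred1 [tuple])); last first.
    by move=> t; apply/esym/eqP/tuple0.
  by rewrite big_pred1_eq big_nil mul1e; congr g; apply: val_inj.
have mgx x : measurable_fun [set: n.-tuple (borel T)]
    (fun t => g (cons_tuple x t)).
  by apply: measurableT_comp => //; exact: measurable_cons.
have mgt (t : n.-tuple (borel T)) : measurable_fun [set: borel T]
    (fun x => g (cons_tuple x t)).
  by apply: measurableT_comp => //; exact: measurable_cons.
under eq_integral do rewrite IH//.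
have prod0 (t : n.-tuple X) : 0 <= \prod_(x <- t) p x by exact: prodr_ge0.
rewrite (integral_discrete_probability _ _ _ _ p0 p1); last 2 first.
- apply: emeasurable_sum => t; exact: measurable_funeM.
- by move=> x; apply: sume_ge0 => t _; rewrite mule_ge0// lee_fin.
rewrite big_tuple_cons; apply: eq_bigr => x _.
rewrite ge0_sume_distrr => [|t _]; last by rewrite mule_ge0// lee_fin.
apply: eq_bigr => t _; rewrite big_cons EFinM muleA.
by congr (_ * g _)%E; apply: val_inj.
Qed.

End iid_discrete.

(** The supremum dominates the average risk over the laws [Pr tau]; once sum and integral are
    exchanged, Assouad's bound applies for each fixed seed [u]. The factor [1 / 32] is that of
    [eps / 4]. *)
Lemma minimax_packing_lower_bound (R : realType) (T : pointedMetricType R)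
    (r s : R) (n k : nat) (f : 'I_k -> T)
    (dU : measure_display) (U : measurableType dU) (Q : probability U R)
    (Phat : U -> n.-tuple (borel T) -> Prob T) :
  0 < r -> 0 < s -> (0 < n)%N -> (2 <= k <= 32 * n)%N ->
  (forall i j, i != j -> s <= mdist (f i) (f j)) ->
  (forall P : Prob T,
     measurable_fun [set: U * n.-tuple (borel T)]
       (fun ux => ((Wass r P (Phat ux.1 ux.2)) `^ r)%E : \bar R)) ->
  (((s / 2) `^ r * (Num.sqrt ((k%:R - 1) / n%:R) / 32))%:E <=
   ereal_sup [set (\int[Q]_u iid_int P (fun x => ((Wass r P (Phat u x)) `^ r)%E))%E
                | P in [set: Prob T]])%E.
Proof.
move=> r0 s0 n0 /andP[k2 kn] sep mPhat; set M := ereal_sup _.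
pose m := k./2; have m0 : (0 < m)%N by rewrite half_gt0.
have mk : (2 * m <= k)%N by rewrite mul2n -[leqRHS]odd_double_half leq_addl.
(* The pair [j] consists of the points of index [j] and [j + m]; an odd [k] leaves one point out. *)
pose code (x : 'I_m * bool) : nat := (x.1 + x.2 * m)%N.
have codek x : (code x < k)%N.
  case: x => j b; rewrite /code /= (leq_trans _ mk)// mul2n -addnn.
  case: b; rewrite ?mul1n ?mul0n ?addn0 ?ltn_add2r//.
  by rewrite (leq_trans (ltn_ord j))// leq_addr.
pose pt (x : 'I_m * bool) : T := f (Ordinal (codek x)).
have ptsep x y : x != y -> s <= mdist (pt x) (pt y).
  move=> xy; apply: sep; apply: contra_neq xy => -[].
  case: x y => [i b] [j c]; rewrite /code /=.
  case: b c => -[]; rewrite ?mul1n ?mul0n ?addn0.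
  - by move/addIn/val_inj ->.
  - by move=> E; have := ltn_ord j; rewrite -E ltnNge leq_addl.
  - by move=> E; have := ltn_ord i; rewrite E ltnNge leq_addl.
  - by move/val_inj ->.
(* With the factor [1 / 8], [k <= 32 n] gives [eps <= 1], and [k - 1 <= 2 m] gives [n eps ^+ 2 / m =
   (k - 1) / (64 m) <= 1 / 32]. *)
pose eps : R := Num.sqrt ((k%:R - 1) / n%:R) / 8.
have k1 : 1 <= k%:R :> R by rewrite ler1n ltnW.
have nR : 0 < n%:R :> R by rewrite ltr0n.
have eps2 : eps ^+ 2 = (k%:R - 1) / n%:R / 64.
  rewrite expr_div_n sqr_sqrtr; first by congr (_ / _); ring.
  by rewrite divr_ge0// subr_ge0.
have eps0 : 0 <= eps by rewrite divr_ge0// sqrtr_ge0.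
have eps01 : 0 <= eps <= 1.
  rewrite eps0 -(@ler_pXn2r _ 2)// ?nnegrE// expr1n eps2.
  rewrite ler_pdivrMr// ler_pdivrMr// mul1r.
  have : k%:R <= (32 * n)%:R :> R by rewrite ler_nat.
  rewrite natrM; lra.
have neps : n%:R * (eps ^+ 2 / m%:R) <= 1 / 32.
  have km : (k%:R - 1 <= 2 * m%:R :> R).
    rewrite lerBlDr -natrM natr1 ler_nat mul2n -[leqLHS]odd_double_half -addn1.
    by rewrite addnC leq_add2l; case: odd.
  have mR : 0 < m%:R :> R by rewrite ltr0n.
  rewrite eps2 [leLHS](_ : _ = (k%:R - 1) / (64 * m%:R)); last first.
    by field; rewrite !gt_eqF.
  by rewrite ler_pdivrMr ?mulr_gt0//; lra.
pose pw := paired_weight R m eps.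
pose Pr tau : Prob T := discrete_probability (pt : _ -> borel T)
  (paired_weight_ge0 R m eps eps01 tau) (sum_paired_weight R m eps m0 tau).
pose W tau u x : \bar R := (Wass r (Pr tau) (Phat u x) `^ r)%E.
pose N := #|{ffun 'I_m -> bool}|.
have N0 : (0 < N)%N by apply/card_gt0P; exists [ffun=> true].
have mW tau t : measurable_fun [set: U] (W tau ^~ t).
  exact: (measurableT_comp (mPhat _) (measurable_pair2 t)).
have WM : (\sum_tau \int[Q]_u iid_int (Pr tau) (W tau u) <= N%:R%:E * M)%E.
  rewrite (le_trans (y := \sum_(tau : {ffun 'I_m -> bool}) M)%E)//.
    by apply: lee_sum => tau _; apply: ereal_sup_ubound; exists (Pr tau).
  by rewrite sumr_const -/N mule_natl.
have NR : 0 < N%:R :> R by rewrite ltr0n.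
rewrite -(@lee_pmul2l _ N%:R%:E)// (le_trans _ WM)//.
have iidE tau u : iid_int (Pr tau) (W tau u) =
    (\sum_(t : n.-tuple ('I_m * bool)) (\prod_(x <- t) pw tau x)%:E *
       W tau u (map_tuple pt t))%E.
  apply: iid_int_discrete => [|t]; last exact: poweR_ge0.
  exact: (measurableT_comp (mPhat _) (measurable_pair1 u)).
have prod0 tau (t : n.-tuple ('I_m * bool)) : 0 <= \prod_(x <- t) pw tau x.
  by apply: prodr_ge0 => x _; exact: paired_weight_ge0.
have miid tau : measurable_fun [set: U] (fun u => iid_int (Pr tau) (W tau u)).
  under eq_fun do rewrite iidE.
  by apply: emeasurable_sum => t; exact: measurable_funeM.
have iid0 tau u : (0 <= iid_int (Pr tau) (W tau u))%E.
  by rewrite iidE sume_ge0// => t _; rewrite mule_ge0 ?lee_fin ?poweR_ge0.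
rewrite -ge0_integral_sum//.
rewrite -EFinM -[leLHS]mule1 -(probability_setT Q) -integral_cst//.
apply: ge0_le_integral => //.
- move=> u _; rewrite lee_fin !mulr_ge0 ?powR_ge0 ?invr_ge0 ?sqrtr_ge0//.
- exact: emeasurable_sum.
move=> u _.
(* The estimate is read only through the masses it gives to the disjoint balls, which sum to at most
   1. *)
pose q (t : n.-tuple ('I_m * bool)) x :=
  fine (Phat u (map_tuple pt t) (ball (pt x) (s / 2))).
have Wq tau t : (((s / 2) `^ r * \sum_x Num.max 0 (pw tau x - q t x))%:E <=
    W tau u (map_tuple pt t))%E.
  apply: Wass_pow_ge_mass_deficit => // x.
  by apply: discrete_probability_ge; exact: measurable_metric_set1.
apply: (@le_trans _ _ (((s / 2) `^ r * \sum_tau \sum_(t : n.-tuple ('I_m * bool))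
    (\prod_(x <- t) pw tau x) * \sum_x Num.max 0 (pw tau x - q t x))%:E)); last first.
  rewrite mulr_sumr -sumEFin; apply: lee_sum => tau _.
  rewrite mulr_sumr -sumEFin iidE; apply: lee_sum => t _.
  by rewrite mulrCA EFinM lee_wpmul2l// lee_fin.
rewrite lee_fin mulrCA ler_wpM2l ?powR_ge0//.
have := assouad R m eps m0 eps01 n q neps (fun t => sum_ball_le1 _ _ _ _ _ ptsep).
by congr (_ * _ <= _); rewrite /eps; field.
Qed.

(** * From separated points to the packing radius *)

Lemma exists_separated_points (R : realType) (T : pointedMetricType R)
    (A : set T) (k : nat) : (2 <= k)%N -> atleast A k ->
  exists2 s : R, 0 <= s & Sep A = s%:E /\
    exists f : 'I_k -> T, forall i j, i != j -> s <= mdist (f i) (f j).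
Proof.
move=> k2 [f [finj fA]].
have fsep i j : i != j -> (Sep A <= (mdist (f i) (f j))%:E)%E.
  move=> ij; apply: ereal_inf_lbound; exists (f i), (f j); split=> // /finj.
  exact/eqP.
have Sep0 : (0 <= Sep A)%E.
  by apply: le_ereal_inf_tmp => _ [x [y [_ _ _ ->]]]; rewrite lee_fin mdist_ge0.
have Sepfin : Sep A \is a fin_num.
  rewrite ge0_fin_numE//.
  have i01 : Ordinal (ltnW k2) != Ordinal k2 by [].
  by rewrite (le_lt_trans (fsep _ _ i01))// ltry.
exists (fine (Sep A)); first exact: fine_ge0.
split; first by rewrite fineK.
by exists f => i j /fsep; rewrite -lee_fin fineK.
Qed.

(** Solving for [z] turns the hypothesis into the upper bound [(M / c) ^ (1 / r)] on [D], which
    passes to the supremum even when it is infinite. *)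
Lemma poweR_mul_le_ereal_sup (R : realType) (r c : R) (D : set (\bar R))
    (M : \bar R) : 0 < r -> 0 < c -> (0 <= M)%E ->
  (forall z, D z -> 0 <= z)%E ->
  (forall z, D z -> z `^ r * c%:E <= M)%E ->
  (ereal_sup D `^ r * c%:E <= M)%E.
Proof.
move=> r0 c0 M0 D0 DM.
have [->|/set0P[z Dz]] := eqVneq D set0.
  (* The empty supremum is [-oo], whose [r]-th power is [0] by convention. *)
  by rewrite ereal_sup0 poweRNyr ?gt_eqF// mul0e.
rewrite -lee_pdivlMr//.
have sup0 : (0 <= ereal_sup D)%E by rewrite (le_trans (D0 _ Dz))// ereal_sup_ubound.
have Mc0 : (0 <= M * (c^-1)%:E)%E by rewrite mule_ge0// lee_fin invr_ge0 ltW.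
have in0y (x : \bar R) : (0 <= x)%E -> x \in `[0%E, +oo%E].
  by move=> x0; rewrite in_itv /= x0 leey.
rewrite -[leRHS]poweRe1// -(mulVf (lt0r_neq0 r0)) poweRrM.
apply: gt0_ler_poweR; [exact: ltW|exact: in0y|by rewrite in0y// poweR_ge0|].
apply: ge_ereal_sup => y Dy.
rewrite -[leLHS]poweRe1 ?D0// -[1](mulfV (lt0r_neq0 r0)) poweRrM.
apply: gt0_ler_poweR; [|by rewrite in0y// poweR_ge0|exact: in0y|].
  by rewrite invr_ge0 ltW.
by rewrite lee_pdivlMr// DM.
Qed.

Theorem theorem3 (R : realType) (T : pointedMetricType R) (r : R) (n : nat)
  (hr : 1 <= r) (hn : (1 <= n)%N)
  (dU : measure_display) (U : measurableType dU) (Q : probability U R)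
  (Phat : U -> n.-tuple (borel T) -> Prob T)
  (Phat_meas : forall P : Prob T,
     measurable_fun [set: U * n.-tuple (borel T)]
       (fun ux => ((Wass r P (Phat ux.1 ux.2)) `^ r)%E : \bar R)) :
  ((3 * ln 2 / 2 `^ (r + 12))%:E *
     ereal_sup [set ((packing_radius T k) `^ r)%E * (Num.sqrt ((k%:R - 1) / n%:R))%:E
               | k in [set k : nat | (2 <= k <= 32 * n)%N]]
   <= ereal_sup [set (\int[Q]_u iid_int P (fun x => ((Wass r P (Phat u x)) `^ r)%E))%E
                | P in [set: Prob T]])%E.
Proof.
set M := ereal_sup [set (\int[Q]_u _)%E | P in _].
have r0 : 0 < r by rewrite (lt_le_trans ltr01).
have iid0 m (P : Prob T) (g : m.-tuple (borel T) -> \bar R) :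
    (forall t, 0 <= g t)%E -> (0 <= iid_int P g)%E.
  elim: m g => [|m IH] g g0 /=; first exact: g0.
  by apply: integral_ge0 => x _; apply: IH => t; exact: g0.
(* Settles the cases where the left-hand side vanishes; the Dirac mass shows that the supremum is
   over a nonempty set. *)
have M0 : (0 <= M)%E.
  pose P0 : Prob T := \d_(point : borel T).
  apply: le_trans; last by apply: ereal_sup_ubound; exists P0.
  by apply: integral_ge0 => u _; apply: iid0 => t; exact: poweR_ge0.
set c : R := 3 * ln 2 / 2 `^ (r + 12).
have c0 : 0 < c by rewrite divr_gt0 ?powR_gt0// mulr_gt0// ln_gt0// ltr1n.
rewrite muleC -lee_pdivlMr//; apply: ge_ereal_sup => _ [k /andP[k2 kn] <-].
rewrite lee_pdivlMr//.
set w : R := Num.sqrt _.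
have w0 : 0 < w by rewrite sqrtr_gt0 divr_gt0 ?ltr0n// subr_gt0 ltr1n.
rewrite -muleA -EFinM; have wc0 : 0 < w * c by rewrite mulr_gt0.
rewrite /packing_radius; case: ifPn => _; last first.
  by rewrite poweR0r ?gt_eqF// mul0e.
(* The packing radius may be infinite, so [M] is compared with each finite [Sep A] before taking the
   supremum. *)
apply: poweR_mul_le_ereal_sup => // _ [A Ak <-];
  have [s s0 [-> [f fsep]]] := exists_separated_points R T A k k2 Ak.
  by rewrite lee_fin.
rewrite poweR_EFin -EFinM.
have [s_eq0|s_gt0] : s = 0 \/ 0 < s.
  by case: ltgtP s0 => // [|<-]; [right|left].
  by rewrite s_eq0 powR0 ?gt_eqF// mul0r.
apply: le_trans (minimax_packing_lower_bound R T r s n k f dU U Q Phat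
  r0 s_gt0 hn _ fsep Phat_meas); last by rewrite k2 kn.
rewrite lee_fin powRM ?invr_ge0// -mulrA ler_wpM2l ?powR_ge0//.
have p0 : 0 < (2 `^ r)^-1 :> R by rewrite invr_gt0 powR_gt0.
rewrite -powR_inv1// -powRrM mulN1r powRN.
(* Since [2 ^ 12 = 4096], the remaining claim is [3 ln 2 / 4096 <= 1 / 32], for which this crude
   bound suffices. *)
have ln2 : ln 2 < 2 :> R by exact: ln_sublinear.
have -> : w * c = (2 `^ r)^-1 * w * (3 * ln 2 / 4096).
  rewrite /c powRD ?pnatr_eq0 ?implybT// powR_mulrn//.
  by field; rewrite gt_eqF// powR_gt0.
rewrite -mulrA ler_wpM2l ?(ltW p0)// ler_wpM2l ?(ltW w0)//; lra.
Qed.
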